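(* There exists a class of graphs $\mathcal{C}$ that is hereditary, almost wide, and has locally bounded treewidth, such that posets of height $2$ with cover graphs in $\mathcal{C}$ have unbounded dimension; that is, for every integer $d$ there is a finite poset $P$ of height $2$ whose cover graph is in $\mathcal{C}$ and with $\dim(P)\geq d$.
   Context: All posets are finite; all graphs are finite, simple and undirected. The height of a poset is the maximum size of a chain. The cover graph of a poset $P$ is the undirected graph on the points of $P$ whose edges are the pairs $\{x,y\}$ with $x<y$ in $P$ and no $z\in P$ with $x<z<y$ in $P$. The dimension $\dim(P)$ is the least $d$ such that there are $d$ linear extensions of $P$ whose intersection is $P$. A class of graphs is hereditary if it is closed under taking induced subgraphs. The distance between two vertices is the length of a shortest path between them ($+\infty$ if they are in distinct components), and $N^r(v)$ is the set of vertices at distance at most $r$ from $v$ in $G$. A class $\mathcal{C}$ has locally bounded treewidth if there is a function $f:\mathbb{R}\to\mathbb{R}$ such that the treewidth of $G[N^r(v)]$ is at most $f(r)$ for every integer $r\geq 0$, every $G\in\mathcal{C}$ and every $v\in V(G)$. For $d\geq 1$, a set $X$ of vertices of $G$ is $d$-independent if every two distinct vertices of $X$ are at distance strictly greater than $d$ in $G$. A class $\mathcal{C}$ is almost wide if there exists an integer $s\geq 0$ such that for every integer $d\geq 1$ there is a function $f:\mathbb{R}\to\mathbb{R}$ such that for every integer $m\geq 1$, every graph $G\in\mathcal{C}$ with at least $f(m)$ vertices contains a subset $S$ of at most $s$ vertices such that $G-S$ has a $d$-independent set of size $m$. *)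

(* Defs.v *)
From HB Require Import structures.
From mathcomp Require Import all_boot all_order.
From mathcomp Require Import boolp.

Set Implicit Arguments.
Unset Strict Implicit.
Unset Printing Implicit Defensive.

Import Order.TTheory.

Record sgraph := SGraph {
  svertex :> finType;
  sedge : rel svertex;
  sedge_sym : symmetric sedge;
  sedge_irrefl : irreflexive sedge }.

Arguments sedge {s} : rename.

Section Induced.
Variables (G : sgraph) (S : {set G}).

Definition induced_edge : rel {x : G | x \in S} :=
  fun x y => sedge (val x) (val y).

Lemma induced_edge_sym : symmetric induced_edge.
Proof. by move=> x y; apply: sedge_sym. Qed.

Lemma induced_edge_irrefl : irreflexive induced_edge.
Proof. by move=> x; apply: sedge_irrefl. Qed.

Definition induced : sgraph := SGraph induced_edge_sym induced_edge_irrefl.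

End Induced.

Definition delete_vertices (G : sgraph) (S : {set G}) : sgraph :=
  induced (~: S).

Definition isomorphic (G H : sgraph) : Prop :=
  exists2 f : G -> H,
    bijective f & forall x y : G, sedge (f x) (f y) = sedge x y.

Record graph_class := GraphClass {
  in_class :> sgraph -> Prop;
  in_class_iso : forall G H : sgraph,
    isomorphic G H -> in_class G -> in_class H }.

Definition hereditary (C : graph_class) : Prop :=
  forall (G : sgraph) (S : {set G}), C G -> C (induced S).

Section Distance.
Variable G : sgraph.

Definition has_path (x y : G) (n : nat) : Prop :=
  exists p : seq G,
    [/\ path sedge x p, uniq (x :: p), last x p = y & size p = n].

Lemma has_pathP (x y : G) :
  (exists n, has_path x y n) -> exists n, `[< has_path x y n >].
Proof. by case=> n xy_n; exists n; apply/asboolP. Qed.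

(* [None] stands for an infinite distance. *)
Definition dist (x y : G) : option nat :=
  if pselect (exists n, has_path x y n) is left xy
  then Some (ex_minn (has_pathP xy)) else None.

Definition dist_le (x y : G) (r : nat) : bool :=
  if dist x y is Some n then n <= r else false.

Definition neighborhood (r : nat) (v : G) : {set G} :=
  [set w | dist_le v w r].

Definition independent (d : nat) (X : {set G}) : Prop :=
  {in X &, forall x y, x != y -> ~~ dist_le x y d}.

End Distance.

Definition connected (G : sgraph) : Prop :=
  forall x y : G, connect sedge x y.

Definition is_tree (T : sgraph) : Prop :=
  [/\ 0 < #|T|, connected T
    & forall c : seq T, ucycle sedge c -> size c <= 2].

Record tree_decomposition (G : sgraph) := TreeDecomposition {
  td_tree : sgraph;
  td_bag : td_tree -> {set G};
  td_treeP : is_tree td_tree;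
  td_vertex : forall v : G, exists t, v \in td_bag t;
  td_edge : forall u v : G, sedge u v ->
    exists t, (u \in td_bag t) && (v \in td_bag t);
  td_connected : forall v : G, connected (induced [set t | v \in td_bag t]) }.

(* The predecessor is truncated, so the empty graph gets treewidth 0. *)
Definition width (G : sgraph) (D : tree_decomposition G) : nat :=
  (\max_(t : td_tree D) #|td_bag t|).-1.

Section TreewidthExists.
Variable G : sgraph.

Fact point_sym : symmetric (fun _ _ : unit => false).
Proof. by []. Qed.

Fact point_irrefl : irreflexive (fun _ : unit => fun _ : unit => false).
Proof. by []. Qed.

Let point := SGraph point_sym point_irrefl.

Lemma trivial_decomposition : exists k : nat,
  `[< exists D : tree_decomposition G, width D = k >].
Proof.
have D : tree_decomposition G.
  apply: (@TreeDecomposition G point (fun _ => [set: G])).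
  - split; first by rewrite card_unit.
    + by case; case; apply: connect0.
    + by case=> [|a [|b [|c s]]] //= /andP [].
  - by move=> v; exists tt; rewrite inE.
  - by move=> u v _; exists tt; rewrite !inE.
  - by move=> v [[] p] [[] q]; rewrite (bool_irrelevance p q) connect0.
by exists (width D); apply/asboolP; exists D.
Qed.

End TreewidthExists.

Definition treewidth (G : sgraph) : nat := ex_minn (trivial_decomposition G).

Definition locally_bounded_treewidth (C : graph_class) : Prop :=
  exists f : nat -> nat, forall (r : nat) (G : sgraph) (v : G),
    C G -> treewidth (induced (neighborhood r v)) <= f r.

Definition almost_wide (C : graph_class) : Prop :=
  exists s : nat, forall d : nat, 1 <= d ->
  exists f : nat -> nat, forall m : nat, 1 <= m ->
  forall G : sgraph, C G -> f m <= #|G| ->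
  exists2 S : {set G}, #|S| <= s &
  exists2 X : {set delete_vertices S}, independent d X & #|X| = m.

Section Posets.
Variables (disp : Order.disp_t) (P : finPOrderType disp).
Local Open Scope order_scope.

Definition chain (A : {set P}) : bool :=
  [forall x in A, forall y in A, x >=< y].

Definition height : nat := \max_(A : {set P} | chain A) #|A|.

Definition covers (x y : P) : bool :=
  (x < y) && ~~ [exists z : P, (x < z) && (z < y)].

Definition cover_edge : rel P := fun x y => covers x y || covers y x.

Lemma cover_edge_sym : symmetric cover_edge.
Proof. by move=> x y; rewrite /cover_edge orbC. Qed.

Lemma cover_edge_irrefl : irreflexive cover_edge.
Proof. by move=> x; rewrite /cover_edge /covers ltxx. Qed.

Definition cover_graph : sgraph := SGraph cover_edge_sym cover_edge_irrefl.

Definition linear_extension (L : rel P) : Prop :=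
  [/\ reflexive L, antisymmetric L, transitive L, total L
    & forall x y, x <= y -> L x y].

Definition realizer (n : nat) (L : 'I_n -> rel P) : Prop :=
  (forall i, linear_extension (L i)) /\
  forall x y : P, (x <= y) = [forall i, L i x y].

Let order_ext (L : rel P) : Prop :=
  [/\ reflexive L, antisymmetric L, transitive L
    & forall x y, x <= y -> L x y].

Let add_pair (L : rel P) (x y : P) : rel P :=
  fun a b => L a b || L a x && L y b.

Let add_pairP (L : rel P) (x y : P) :
  order_ext L -> ~~ L y x -> order_ext (add_pair L x y).
Proof.
case=> Lr La Lt Le Nyx; split.
- by move=> a; rewrite /add_pair Lr.
- move=> a b /andP [] /orP [ab|/andP [ax yb]] /orP [ba|/andP [bx ya]].
  + by apply: La; rewrite ab ba.
  + by case/negP: Nyx; apply: (Lt _ _ _ ya); apply: Lt ab bx.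
  + by case/negP: Nyx; apply: (Lt _ _ _ yb); apply: Lt ba ax.
  + by case/negP: Nyx; apply: Lt ya ax.
- move=> b a c; rewrite /add_pair.
  move=> /orP [ab|/andP [ax yb]] /orP [bc|/andP [bx yc]].
  + by rewrite (Lt _ _ _ ab bc).
  + by rewrite (Lt _ _ _ ab bx) yc orbT.
  + by rewrite ax (Lt _ _ _ yb bc) orbT.
  + by rewrite ax yc orbT.
- by move=> a b ab; rewrite /add_pair Le.
Qed.

Lemma extend_order (L : rel P) : order_ext L ->
  exists2 M, linear_extension M & forall x y, L x y -> M x y.
Proof.
move=> extL; pose rl (A : {set P * P}) : rel P := fun x y => (x, y) \in A.
have rlK (K : rel P) : rl [set p | K p.1 p.2] = K.
  by apply/funext => x; apply/funext => y; rewrite /rl inE.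
have: `[< order_ext (rl [set p | L p.1 p.2]) >] by rewrite rlK; apply/asboolP.
case/(@maxset_exists _ (fun A => `[< order_ext (rl A) >])) => B.
case/maxsetP=> /asboolP extB maxB /subsetP LB.
exists (rl B); last by move=> x y xy; apply: LB; rewrite inE.
case: (extB) => Br Ba Bt Be; split=> // x y.
apply/orP; case: (boolP (rl B y x)) => [|Nyx]; [by right | left].
rewrite /rl -(maxB [set p | add_pair (rl B) x y p.1 p.2]).
- by rewrite inE /= /add_pair !Br orbT.
- by rewrite rlK; apply/asboolP; apply: add_pairP.
- by apply/subsetP => -[a b] ab; rewrite inE /= /add_pair /rl ab.
Qed.

Lemma realizer_exists :
  exists n : nat, `[< exists L : 'I_n -> rel P, realizer L >].
Proof.
have ext0 : order_ext (fun x y => x <= y).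
  by split=> //; [apply: le_anti | apply: le_trans].
have sep (p : P * P) :
    exists M, linear_extension M /\ M p.1 p.2 = (p.1 <= p.2).
  case: p => x y /=; case: (boolP (x <= y)) => [xy|Nxy].
    by have [M extM leM] := extend_order ext0; exists M; split; rewrite ?leM.
  have [M extM leM] := extend_order (add_pairP ext0 Nxy).
  exists M; split=> //; case: (extM) => _ Ma _ _ _.
  apply/negbTE/negP => Mxy; case/negP: Nxy.
  have Myx : M y x by apply: leM; rewrite /add_pair !lexx orbT.
  by rewrite (Ma x y) ?Mxy ?Myx.
have [M MP] := choice sep.
exists #|{: P * P}|; apply/asboolP; exists (fun i => M (enum_val i)).
split=> [i|x y]; first by case: (MP (enum_val i)).
apply/idP/forallP => [xy i|/(_ (enum_rank (x, y)))].
  by case: (MP (enum_val i)) => -[_ _ _ _ leM] _; apply: leM.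
by rewrite enum_rankK; case: (MP (x, y)) => _ /= ->.
Qed.

(* The empty intersection is the full relation, so posets with at most one
   point have dimension 0. *)
Definition dim : nat := ex_minn realizer_exists.

End Posets.

Arguments height {disp} P.
Arguments cover_graph {disp} P.
Arguments dim {disp} P.

(* Main.v *)
(* Large girth makes a graph class wide and locally tree-like; large dimension
   is obtained by counting.  Fix [g] and [d].  An edge-maximal bipartite graph
   on [n + n] vertices, among those of girth greater than [g] and of maximum
   degree at most [D], where [n = 2 * D.+1 ^ g], has at least [n * D / 2]
   edges.  Each of the [2 ^ (n * D / 2)] subsets of these edges is a height-2
   poset, whereas posets of dimension less than [d] on [N = 2 * n] points are
   determined by [d] rankings of the points, so there are at most
   [N.+1 ^ (d * N)] of them.  As [log N] is of order [g * log D], the first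
   number wins for large [D].

   The class consists of the graphs that, for every [g], have girth greater
   than [g] or at most [M g] vertices.  For large girth, balls are trees, and
   wideness is a dichotomy: after deletion of a vertex of large degree its
   neighbors are pairwise far apart, while in a graph of bounded degree a large
   [d]-independent set is found greedily.  *)
Require Import Defs.
From HB Require Import structures.
From mathcomp Require Import all_boot all_order zify.
From mathcomp Require Import boolp.

Set Implicit Arguments.
Unset Strict Implicit.
Unset Printing Implicit Defensive.

(** * Girth as uniqueness of short paths *)

(* Equivalently, the girth exceeds [g]. *)
Definition unique_short_paths (T : finType) (e : rel T) (g : nat) : Prop :=
  forall x p q, path e x p -> uniq (x :: p) -> path e x q -> uniq (x :: q) ->
  last x p = last x q -> size p + size q <= g -> p = q.

Lemma unique_short_paths_leq (T : finType) (e : rel T) (g h : nat) :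
  h <= g -> unique_short_paths e g -> unique_short_paths e h.
Proof.
move=> hg U x p q ep up eq uq pq s; apply: (U x) => //; exact: leq_trans s hg.
Qed.

(** Edges are only preserved, not reflected, so the girth condition passes to all subgraphs, induced
    or not. *)
Lemma unique_short_paths_inj (T T' : finType) (e : rel T) (e' : rel T')
    (f : T' -> T) (g : nat) :
  injective f -> (forall x y, e' x y -> e (f x) (f y)) ->
  unique_short_paths e g -> unique_short_paths e' g.
Proof.
move=> f_inj fe U x p q ep up eq uq pq s.
have map_e r : path e' x r -> path e (f x) (map f r).
  by move=> er; rewrite path_map; apply: sub_path er.
apply: (inj_map f_inj); apply: (U (f x)); rewrite ?map_e ?size_map //.
- by rewrite -map_cons map_inj_uniq.
- by rewrite -map_cons map_inj_uniq.
- by rewrite !last_map pq.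
Qed.

Lemma card_bigcup_leq (I T : finType) (A : {set I}) (F : I -> {set T}) :
  #|\bigcup_(i in A) F i| <= \sum_(i in A) #|F i|.
Proof.
elim/big_rec2: _ => [|i c S _ le_c]; first by rewrite cards0.
by rewrite (leq_trans (leq_card_setU _ _)) // leq_add2l.
Qed.

(** * Balls and their sizes *)

Section Balls.
Variables (T : finType) (e : rel T).

Definition neighbors (x : T) : {set T} := [set y | e x y].

Fixpoint ball (n : nat) (x : T) : {set T} :=
  if n is n'.+1 then \bigcup_(y in ball n' x) (y |: neighbors y) else [set x].

Lemma ballP (n : nat) (x y : T) :
  reflect (exists p, [/\ path e x p, last x p = y & size p <= n])
    (y \in ball n x).
Proof.
elim: n y => [|n IHn] y /=.
  rewrite inE; apply: (iffP eqP) => [->|[[|z p] [] //=]]; by [exists [::]|].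
apply: (iffP bigcupP) => [[z /IHn [p [ep <- sp]]]|[p [ep <- sp]]].
  rewrite !inE => /orP [/eqP ->|zy]; first by exists p; split=> //; apply: ltnW.
  by exists (rcons p y); rewrite rcons_path last_rcons size_rcons ep zy.
case/lastP: p ep sp => [|p z].
  move=> _ _; exists x; last by rewrite !inE eqxx.
  by apply/IHn; exists [::].
rewrite rcons_path last_rcons size_rcons => /andP [ep ez] sp.
exists (last x p); last by rewrite !inE ez orbT.
by apply/IHn; exists p.
Qed.

Lemma ball_trans (m n : nat) (x y z : T) :
  y \in ball m x -> z \in ball n y -> z \in ball (m + n) x.
Proof.
move=> /ballP [p [ep <- sp]] /ballP [q [eq <- sq]]; apply/ballP.
by exists (p ++ q); rewrite cat_path last_cat size_cat ep eq leq_add.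
Qed.

Lemma ball_path (x : T) (p : seq T) :
  path e x p -> last x p \in ball (size p) x.
Proof. by move=> ep; apply/ballP; exists p. Qed.

Lemma ball_leq (m n : nat) (x y : T) :
  m <= n -> y \in ball m x -> y \in ball n x.
Proof.
move=> mn /ballP [p [ep py sp]]; apply/ballP; exists p; split=> //.
exact: leq_trans sp mn.
Qed.

Lemma ball_sym (n : nat) (x y : T) :
  symmetric e -> y \in ball n x -> x \in ball n y.
Proof.
move=> e_sym /ballP [p [ep <- sp]]; apply/ballP.
exists (rev (belast x p)); rewrite rev_path size_rev size_belast; split=> //.
  by rewrite (eq_path (e' := e)) // => a b; apply: e_sym.
by case: p {ep sp} => //= y0 p; rewrite rev_cons last_rcons.
Qed.

Lemma card_ball (D n : nat) (x : T) :
  (forall y, #|neighbors y| <= D) -> #|ball n x| <= D.+1 ^ n.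
Proof.
move=> degD; elim: n => [|n IHn] /=; first by rewrite cards1.
apply: leq_trans (card_bigcup_leq _ _) _.
apply: (@leq_trans (\sum_(y in ball n x) D.+1)).
  apply: leq_sum => y _; rewrite cardsU1.
  by apply: leq_trans (leq_add (leq_b1 _) (degD y)) _.
by rewrite sum_nat_const expnSr leq_mul2r IHn orbT.
Qed.

End Balls.

(** * Joining two distant vertices by an edge *)

Section AddEdge.
Variables (T : finType) (e : rel T) (a b : T) (g : nat).
Hypothesis e_sym : symmetric e.

Definition add_edge : rel T :=
  fun x y => [|| e x y, (x == a) && (y == b) | (x == b) && (y == a)].

Lemma add_edge_path (c : T) (x : T) (p : seq T) : c \in [:: a; b] ->
  c \notin x :: p -> path add_edge x p -> path e x p.
Proof.
move=> c_ab; elim: p x => //= y p IHp x.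
rewrite in_cons negb_or => /andP [xc yc] /andP [xy yp].
rewrite IHp // andbT; case/or3P: xy => // /andP [/eqP xE /eqP yE].
- by move: c_ab xc yc; rewrite !inE -xE -yE => /orP [] ->.
- by move: c_ab xc yc; rewrite !inE -xE -yE => /orP [] ->; rewrite ?orbT.
Qed.

(** A path without repetitions crosses the new edge at most once; [c] and [c'] record the direction
    of the crossing. *)
Lemma add_edge_split (x : T) (p : seq T) :
  path add_edge x p -> uniq (x :: p) ->
  path e x p \/
  exists c c' q r, [/\ p = q ++ c' :: r, last x q = c, path e x q, path e c' r
    & c = a /\ c' = b \/ c = b /\ c' = a].
Proof.
elim: p x => [|y p IHp] x; first by left.
move=> /= /andP [xy yp] /andP [xp up].
have [exy|nexy] := boolP (e x y).
  case: (IHp y yp up) => [ep|[c [c' [q [r [-> <- eq er cc']]]]]].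
    by left.
  by right; exists (last y q), c', (y :: q), r; split=> //=; rewrite exy.
right; exists x, y, [::], p; split=> //.
  apply: (@add_edge_path x) yp => //; rewrite !inE.
  move: xy; rewrite /add_edge (negbTE nexy) /=.
  by move=> /orP [] /andP [-> _]; rewrite ?orbT.
move: xy; rewrite /add_edge (negbTE nexy) /=.
by move=> /orP [] /andP [/eqP -> /eqP ->]; [left|right].
Qed.

(** If just one of two short paths with common ends uses the new edge, or both cross it in opposite
    directions, then an [e]-walk of length at most [g] joins [a] and [b]. If both cross it the same
    way, their halves agree by uniqueness in [e]. *)
Lemma add_edge_unique_short_paths :
  b \notin ball e g a -> unique_short_paths e g ->
  unique_short_paths add_edge g.
Proof.
move=> far U.
have near c c' n : (c = a /\ c' = b) \/ (c = b /\ c' = a) ->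
    c' \in ball e n c -> n <= g -> False.
  move=> cc' cn ng; case/negP: far; apply: (ball_leq ng).
  by case: cc' cn => [] [-> ->] // /ball_sym; apply.
have back x (q : seq T) : path e x q -> x \in ball e (size q) (last x q).
  by move=> eq; apply: ball_sym => //; apply: ball_path.
(* Only the second path crosses: go from [c] back along [q], then along [p], then back along [r] to
   [c']. *)
have one x p c c' q r : path e x p -> path e x q -> path e c' r ->
    last x q = c -> last x p = last c' r ->
    (c = a /\ c' = b) \/ (c = b /\ c' = a) ->
    size p + (size q + (size r).+1) <= g -> False.
  move=> ep eq er qc pr cc' s.
  apply: (near c c' (size q + size p + size r)) => //; last by clear -s; lia.
  have cx := back _ _ eq; rewrite qc in cx.
  apply: ball_trans (ball_trans cx (ball_path ep)) _.
  by rewrite pr; apply: back.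
move=> x p q ep up eq uq pq s.
case: (add_edge_split ep up) => [ep'|[c [c' [p1 [p2 [pE pc ep1 ep2 cc']]]]]];
case: (add_edge_split eq uq) => [eq'|[k [k' [q1 [q2 [qE qk eq1 eq2 kk']]]]]].
- exact: (U x).
- exfalso; apply: (one x p k k' q1 q2) => //.
    by rewrite pq qE last_cat.
  by rewrite qE size_cat in s.
- exfalso; apply: (one x q c c' p1 p2) => //.
    by rewrite -pq pE last_cat.
  by rewrite pE size_cat in s; rewrite addnC.
- move: pq s up uq; rewrite pE qE !last_cat !size_cat /=.
  rewrite !cat_uniq /= => pq s.
  move=> /and5P [xp up1 _ cp2 up2] /and5P [xq uq1 _ kq2 uq2].
  have [ckE|ckN] := eqVneq c k.
    have ckE' : c' = k'.
      by case: cc' kk' ckE => [] [-> ->] [] [-> ->] // ->.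
    have -> : p1 = q1.
      apply: (U x p1 q1 ep1 _ eq1).
      + by rewrite /= up1 andbT; apply: contra xp; rewrite mem_cat => ->.
      + by rewrite /= uq1 andbT; apply: contra xq; rewrite mem_cat => ->.
      + by rewrite pc qk.
      + by clear -s; lia.
    rewrite ckE'; congr (_ ++ _ :: _).
    apply: (U k' p2 q2 _ _ eq2) => /=; rewrite -?ckE' ?cp2 //.
    - by rewrite ckE' kq2.
    - by rewrite pq ckE'.
    - by clear -s; lia.
  (* Opposite directions, so [k] is the end other than [c]: go back along [p1], then along [q1]. *)
  exfalso; apply: (near c k (size p1 + size q1)); last by clear -s; lia.
    by case: cc' kk' ckN => [] [-> _] [] [-> _]; rewrite ?eqxx; auto.
  have cx := back _ _ ep1; rewrite pc in cx.
  by apply: ball_trans cx _; rewrite -qk ball_path.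
Qed.

Lemma card_neighbors_add_edge (x : T) :
  #|neighbors add_edge x| <= #|neighbors e x| + (x \in [:: a; b]).
Proof.
rewrite !inE; have [xa|xa] /= := eqVneq x a.
  apply: (@leq_trans #|b |: neighbors e x|).
    apply/subset_leq_card/subsetP => y; rewrite !inE /add_edge.
    case/or3P => [->|/andP [_ ->]|/andP [xb ya]]; rewrite ?orbT //.
    by rewrite (eqP ya) -xa xb.
  by rewrite cardsU1 addnC leq_add2l leq_b1.
have [xb|xb] /= := eqVneq x b.
  apply: (@leq_trans #|a |: neighbors e x|).
    apply/subset_leq_card/subsetP => y; rewrite !inE /add_edge.
    by rewrite (negbTE xa) /= => /orP [->|/andP [_ ->]]; rewrite ?orbT.
  by rewrite cardsU1 addnC leq_add2l leq_b1.
rewrite addn0; apply/subset_leq_card/subsetP => y; rewrite !inE /add_edge.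
by rewrite (negbTE xa) (negbTE xb) /= orbF.
Qed.

End AddEdge.

(** * Dense bipartite graphs of large girth *)

Section Bipartite.
Variable n : nat.
Implicit Types E F : {set 'I_n * 'I_n}.

Definition bipartite_edge E : rel ('I_n + 'I_n) := fun x y =>
  match x, y with
  | inl a, inr b => (a, b) \in E
  | inr b, inl a => (a, b) \in E
  | _, _ => false
  end.

Lemma bipartite_edge_sym E : symmetric (bipartite_edge E).
Proof. by case=> a [] b. Qed.

Lemma bipartite_edgeU1 E (a b : 'I_n) :
  bipartite_edge ((a, b) |: E) =2 add_edge (bipartite_edge E) (inl a) (inr b).
Proof.
have inlE (u v : 'I_n) : (inl u == inl v :> 'I_n + 'I_n) = (u == v) by [].
have inrE (u v : 'I_n) : (inr u == inr v :> 'I_n + 'I_n) = (u == v) by [].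
by case=> u [] v; rewrite /add_edge /= ?inE ?inlE ?inrE ?xpair_eqE ?orbF 1?orbC
  // andbC.
Qed.

Lemma card_edges_inl E : #|E| = \sum_a #|neighbors (bipartite_edge E) (inl a)|.
Proof.
rewrite -sum1_card (eq_bigl (fun p => (p.1, p.2) \in E)); last by case.
rewrite -(pair_big_dep xpredT (fun a b => (a, b) \in E) (fun _ _ => 1)) /=.
apply: eq_bigr => a _; rewrite sum1_card.
rewrite -(card_imset [pred b | (a, b) \in E] (@inr_inj 'I_n 'I_n)).
apply: eq_card => -[] y; rewrite inE /=.
  by apply/imsetP => -[].
by apply/imsetP/idP => [[b ab [->]]|ab] //; exists y.
Qed.

Lemma card_edges_inr E : #|E| = \sum_b #|neighbors (bipartite_edge E) (inr b)|.
Proof.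
rewrite -sum1_card (eq_bigl (fun p => (p.1, p.2) \in E)); last by case.
rewrite -(pair_big_dep xpredT (fun a b => (a, b) \in E) (fun _ _ => 1)) /=.
rewrite (exchange_big_dep xpredT) //=.
apply: eq_bigr => b _; rewrite sum1_card.
rewrite -(card_imset [pred a | (a, b) \in E] (@inl_inj 'I_n 'I_n)).
apply: eq_card => -[] y; rewrite inE /=.
  by apply/imsetP/idP => [[a ab [->]]|ab] //; exists y.
by apply/imsetP => -[].
Qed.

(* In an edge-maximal graph, two vertices of degree less than [D] on different
   sides are at distance at most [g]; hence on one of the sides at most
   [D.+1 ^ g] vertices have degree less than [D]. *)
Lemma dense_unique_short_paths (g D : nat) : 0 < g -> n = 2 * D.+1 ^ g ->
  exists2 E, unique_short_paths (bipartite_edge E) g & D.+1 ^ g * D <= #|E|.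
Proof.
move=> g_gt0 nE.
pose ok E := `[< unique_short_paths (bipartite_edge E) g >] &&
  [forall x, #|neighbors (bipartite_edge E) x| <= D].
have ok0 : ok set0.
  have e0 x y : bipartite_edge set0 x y = false.
    by case: x y => a [] b /=; rewrite ?inE.
  apply/andP; split.
    apply/asboolP => x [|y p] [|z q] //=; by rewrite e0.
  apply/forallP => x; rewrite (_ : neighbors _ _ = set0) ?cards0 //.
  by apply/setP => y; rewrite !inE e0.
case: (arg_maxnP (fun E => #|E|) ok0) => E.
move=> /andP [/asboolP UE /forallP degE] maxE.
exists E => //; pose e := bipartite_edge E.
have [/forallP full|/forallPn [a lta]] :=
    boolP [forall a, D <= #|neighbors e (inl a)|].
  rewrite card_edges_inl.
  apply: (@leq_trans (\sum_(a : 'I_n) D)); last by apply: leq_sum.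
  by rewrite sum_nat_const card_ord nE leq_mul2r leq_pmull ?orbT.
rewrite -ltnNge in lta.
pose low := [set b | #|neighbors e (inr b)| < D].
(* For a low [b] outside the ball, adding [(a, b)] would respect girth and degree bounds,
   contradicting maximality. *)
have low_ball : [set inr b | b in low] \subset ball e g (inl a).
  apply/subsetP => _ /imsetP [b + ->]; rewrite inE => ltb.
  apply/negPn/negP => far.
  have abE : (a, b) \notin E.
    apply: contra far => abE; apply: (@ball_leq _ _ 1) => //.
    by apply/ballP; exists [:: inr b]; rewrite /= abE.
  suff okab : ok ((a, b) |: E).
    by have := maxE _ okab; rewrite /= cardsU1 abE add1n ltnn.
  have -> : ok ((a, b) |: E) = (`[< unique_short_paths
        (add_edge e (inl a) (inr b)) g >] &&
      [forall x, #|neighbors (add_edge e (inl a) (inr b)) x| <= D]).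
    rewrite /ok (_ : bipartite_edge _ = add_edge e (inl a) (inr b)) //.
    by apply/funext => x; apply/funext => y; apply: bipartite_edgeU1.
  apply/andP; split.
    apply/asboolP/add_edge_unique_short_paths => //.
    exact: bipartite_edge_sym.
  apply/forallP => x; apply: leq_trans (card_neighbors_add_edge _ _ _ _) _.
  rewrite !inE; have [->|_] := eqVneq x (inl a); first by rewrite addn1.
  have [->|_] := eqVneq x (inr b); first by rewrite addn1.
  by rewrite addn0; apply: degE.
have card_low : #|low| <= D.+1 ^ g.
  rewrite -(card_imset low (@inr_inj 'I_n 'I_n)).
  by apply: leq_trans (subset_leq_card low_ball) (card_ball _ _ degE).
(* Since [n] is twice the bound on [low], at least half of the right vertices have degree at least
   [D]. *)
rewrite card_edges_inr (bigID (mem low)) /=.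
apply: leq_trans (leq_addl _ _).
apply: (@leq_trans (\sum_(b | b \notin low) D)); last first.
  by apply: leq_sum => b; rewrite inE -leqNgt.
rewrite sum_nat_const leq_mul2r; apply/orP; right.
have cardE : #|low| + #|[predC low]| = 2 * D.+1 ^ g.
  by rewrite -nE cardC card_ord.
by rewrite -(leq_add2l #|low|) [X in _ <= X]cardE mul2n -addnn leq_add2r.
Qed.

(** * Height-2 posets from bipartite graphs *)

Definition bipartite_le E : rel ('I_n + 'I_n) := fun x y =>
  (x == y) ||
  (if x is inl a then if y is inr b then (a, b) \in E else false else false).

Lemma bipartite_le_refl E : reflexive (bipartite_le E).
Proof. by move=> x; rewrite /bipartite_le eqxx. Qed.

Lemma bipartite_le_anti E : antisymmetric (bipartite_le E).
Proof.
by case=> a [] b /andP []; rewrite /bipartite_le ?orbF //= => /eqP.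
Qed.

Lemma bipartite_le_trans E : transitive (bipartite_le E).
Proof.
move=> y x z; rewrite {1}/bipartite_le => /orP [/eqP -> //|].
case: x => // a; case: y => // b abE; rewrite {1}/bipartite_le orbF => /eqP <-.
by rewrite /bipartite_le abE orbT.
Qed.

(** Keeping [E] as a parameter of the type gives each edge set its own order instance on the same
    points. *)
Definition bipartite_poset (E : {set 'I_n * 'I_n}) : Type := ('I_n + 'I_n)%type.

HB.instance Definition _ E := Finite.on (bipartite_poset E).
HB.instance Definition _ E :=
  Order.Le_isPOrder.Build (Order.Disp tt tt) (bipartite_poset E)
    (@bipartite_le_refl E) (@bipartite_le_anti E) (@bipartite_le_trans E).

Local Open Scope order_scope.

Lemma bipartite_poset_leE E (x y : bipartite_poset E) :
  (x <= y) = bipartite_le E x y.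
Proof. by []. Qed.

Lemma bipartite_poset_lt E (x y : bipartite_poset E) :
  x < y -> exists a b, [/\ x = inl a, y = inr b & (a, b) \in E].
Proof.
rewrite Order.POrderTheory.lt_neqAle bipartite_poset_leE /bipartite_le.
move=> /andP [/negbTE -> /=]; case: x => // a; case: y => // b abE.
by exists a, b.
Qed.

Lemma cover_edge_bipartite_poset E (x y : bipartite_poset E) :
  cover_edge x y -> bipartite_edge E x y.
Proof.
by case/orP => /andP [/bipartite_poset_lt [a [b [-> -> abE]]]].
Qed.

Lemma height_bipartite_poset E : E != set0 -> height (bipartite_poset E) = 2.
Proof.
case/set0Pn => -[a b] abE; apply/eqP; rewrite eqn_leq; apply/andP; split.
  apply/bigmax_leqP => A chA.
  have cmp (x y : bipartite_poset E) : x \in A -> y \in A -> x >=< y.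
    by move=> xA yA; move/forall_inP: chA => /(_ x xA) /forall_inP /(_ y yA).
  (* Comparable points on the same side are equal, so [left] is injective on a chain. *)
  pose left (x : bipartite_poset E) : bool :=
    if x is inl _ then true else false.
  rewrite -(@card_in_imset _ _ left A) -?card_bool ?max_card // => x y xA yA.
  move: (cmp x y xA yA); rewrite /Order.comparable !bipartite_poset_leE.
  rewrite /bipartite_le [y == x]eq_sym.
  by case: x {xA} => u; case: y {yA} => v; rewrite ?orbF ?orbb //= => /eqP ->.
pose A : {set bipartite_poset E} := [set inl a; inr b].
have <- : #|A| = 2 by rewrite cards2.
apply: (@leq_bigmax_cond _ _ (fun A : {set bipartite_poset E} => #|A|)).
apply/forall_inP => x xA; apply/forall_inP => y; move: xA.
rewrite !inE /Order.comparable !bipartite_poset_leE /bipartite_le.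
by do 2![move=> /orP [/eqP ->|/eqP ->]]; rewrite ?eqxx ?abE ?orbT.
Qed.

End Bipartite.

(** * Counting posets of small dimension *)

(** Down-sets of a total order are nested, so their sizes determine the order. A linear extension
    thus becomes a bounded integer ranking, and these can be counted. *)
Lemma linear_extension_rank (disp : Order.disp_t) (P : finPOrderType disp)
    (L : rel P) (x y : P) : linear_extension L ->
  L x y = (#|[set z | L z x]| <= #|[set z | L z y]|).
Proof.
case=> Lr _ Lt Lto _; apply/idP/idP => [xy|].
  by apply/subset_leq_card/subsetP => z; rewrite !inE => /Lt; apply.
apply: contraTT => Nxy; rewrite -ltnNge; apply/proper_card/properP; split.
  have yx : L y x by have := Lto x y; rewrite (negbTE Nxy).
  by apply/subsetP => z; rewrite !inE => /Lt; apply.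
by exists x; rewrite inE ?Lr.
Qed.

Lemma dim_ranks (disp : Order.disp_t) (P : finPOrderType disp) (d : nat) :
  dim P < d -> exists r : 'I_d -> P -> nat,
    (forall i x, r i x <= #|P|) /\
    forall x y, (x <= y)%O = [forall i, r i x <= r i y].
Proof.
(* Indices beyond the size of the realizer get a constant ranking, which does
   not affect the intersection. *)
rewrite /dim; case: ex_minnP => m /asboolP [L [extL LE]] _ md.
exists (fun i x =>
  if (insub (val i) : option 'I_m) is Some j then #|[set z | L j z x]| else 0).
split=> [i x|x y]; first by case: insubP => // j _ _; apply: max_card.
rewrite LE; apply/forallP/forallP => [le_xy i|le_xy j].
  by case: insubP => // j _ _; rewrite -linear_extension_rank.
have := le_xy (widen_ord (ltnW md) j).
by rewrite /= valK -linear_extension_rank.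
Qed.

(** If all nonempty subsets of [E] gave dimension below [d], each could be decoded from [d] rankings
    of the [n + n] points. The predecessor discards the empty set, whose poset is an antichain. *)
Lemma large_dim_bipartite_poset (n d : nat) (E : {set 'I_n * 'I_n}) :
  (n + n).+1 ^ (d * (n + n)) < (2 ^ #|E|).-1 ->
  exists F : {set 'I_n * 'I_n},
    [/\ F \subset E, F != set0 & d <= dim (bipartite_poset F)].
Proof.
apply: contraPP => none; apply/negP; rewrite -leqNgt.
pose code := {ffun 'I_d * ('I_n + 'I_n) -> 'I_(n + n).+1}.
pose decode (r : code) : {set 'I_n * 'I_n} :=
  [set p | [forall i, r (i, inl p.1) <= r (i, inr p.2)]].
have -> : (n + n).+1 ^ (d * (n + n)) = #|{: code}|.
  by rewrite card_ffun card_prod card_sum !card_ord.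
have -> : (2 ^ #|E|).-1 = #|powerset E :\ set0|.
  by rewrite -card_powerset (cardsD1 set0) inE sub0set.
have codeE (F : {set 'I_n * 'I_n}) : F \in powerset E :\ set0 ->
    exists r, F = decode r.
  rewrite !inE => /andP [F0 FE].
  have [dF|/dim_ranks [r [r_le rE]]] := leqP d (dim (bipartite_poset F)).
    by case: none; exists F.
  have {}r_le i x : r i x < (n + n).+1.
    by rewrite ltnS (leq_trans (r_le i x)) // card_sum !card_ord.
  exists [ffun p => Ordinal (r_le p.1 p.2)]; apply/setP => -[a b].
  transitivity (bipartite_le F (inl a) (inr b)); first by [].
  rewrite inE -(bipartite_poset_leE (E := F)) rE.
  by apply: eq_forallb => i; rewrite !ffunE.
rewrite -cardsT; apply: leq_trans (leq_imset_card decode _).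
apply/subset_leq_card/subsetP => F /codeE [r ->]; exact: imset_f.
Qed.

Lemma linear_leq_exp2 (a b : nat) : exists t, a * t + b <= 2 ^ t.
Proof.
(* [2 ^ (2 * s)] is the square of [2 ^ s], hence at least [(s + 1) ^ 2], which exceeds
   [a * (2 * s) + b]. *)
pose s := 2 * a + b; exists (2 * s).
have le_s : s.+1 <= 2 ^ s := ltn_expl s (ltnSn 1).
have : s.+1 * s.+1 <= 2 ^ (2 * s) by rewrite mul2n -addnn expnD leq_mul.
apply: leq_trans; rewrite /s; nia.
Qed.

Lemma high_dim_bipartite_poset (k : nat) :
  exists (n : nat) (F : {set 'I_n * 'I_n}),
    [/\ unique_short_paths (bipartite_edge F) k, F != set0
      & k <= dim (bipartite_poset F)].
Proof.
pose g := k.+1.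
(* This yields [D >= 4 * k * g * t + 12 * k + 2], where the first two terms add up to [X] divided by
   [B]. *)
have [t t_big] := linear_leq_exp2 (4 * k * g) (12 * k + 3).
pose B := 2 ^ (t * g); pose D := (2 ^ t).-1.
have DE : D.+1 ^ g = B by rewrite /B expnM prednK // expn_gt0.
have [E UE cardE] := @dense_unique_short_paths (2 * B) g D (ltn0Sn k)
  (congr1 (muln 2) (esym DE)).
have [|F [/subsetP FE F0 kF]] := @large_dim_bipartite_poset _ k E; last first.
  exists _, F; split=> //; apply: (unique_short_paths_leq (leqnSn k)).
  apply: (unique_short_paths_inj (f := id)) UE => // -[] a [] b //= /FE //.
rewrite DE in cardE.
have B_gt0 : 0 < B by rewrite expn_gt0.
have -> : 2 * B + 2 * B = 4 * B by lia.
(* There are [4 * B] points, and [4 * B + 1 <= 8 * B = 2 ^ (t * g + 3)]. *)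
pose X := (t * g + 3) * (k * (4 * B)).
have NX : (4 * B).+1 ^ (k * (4 * B)) <= 2 ^ X.
  have [->|e_gt0] := posnP (k * (4 * B)); first by rewrite expn_gt0.
  by rewrite /X [leqRHS]expnM leq_exp2r // expnD -/B; lia.
(* The surplus 2 absorbs the predecessor in the count of nonempty subsets. *)
have XE : X + 2 <= #|E|.
  apply: leq_trans cardE.
  have : 4 * k * g * t + 12 * k + 2 <= D by rewrite /D; lia.
  move/(leq_mul (leqnn B)); apply: leq_trans.
  by rewrite /X; nia.
have : 2 ^ (X + 2) <= 2 ^ #|E| by rewrite leq_exp2l.
have : 0 < 2 ^ X by rewrite expn_gt0.
rewrite expnD; move: NX; clear.
move: (_ ^ _) (2 ^ X) (2 ^ #|E|) => a b c; lia.
Qed.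

(** * The class and its almost-wideness *)

Lemma dist_leP (G : sgraph) (x y : G) (r : nat) :
  reflect (exists p, [/\ path sedge x p, uniq (x :: p), last x p = y
    & size p <= r]) (dist_le x y r).
Proof.
rewrite /dist_le /dist; apply: (iffP idP) => [|[p [xp up py pr]]].
  case: pselect => // xy; case: ex_minnP => n /asboolP [p [xp up py <-]] _ pr.
  by exists p.
case: pselect => [xy|[]]; last by exists (size p), p.
case: ex_minnP => n _ minn; apply: leq_trans pr.
by apply: minn; apply/asboolP; exists p.
Qed.

Lemma dist_le_ball (G : sgraph) (x y : G) (r : nat) :
  dist_le x y r -> y \in ball sedge r x.
Proof. by case/dist_leP => p [xp _ py pr]; apply/ballP; exists p. Qed.

Section Classes.
Variable M : nat -> nat.

Definition sparse (G : sgraph) : Prop :=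
  forall g, unique_short_paths (@sedge G) g \/ #|G| <= M g.

Lemma sparse_embedding (G H : sgraph) (f : H -> G) : injective f ->
  (forall x y, sedge x y -> sedge (f x) (f y)) -> sparse G -> sparse H.
Proof.
move=> f_inj fe spG g; case: (spG g) => [U|le_M]; [left|right].
  exact: unique_short_paths_inj f_inj fe U.
by apply: leq_trans le_M; apply: leq_card f_inj.
Qed.

Lemma sparse_iso (G H : sgraph) : isomorphic G H -> sparse G -> sparse H.
Proof.
case=> f [h fK hK] fe; apply: (sparse_embedding (can_inj hK)) => x y.
by rewrite -fe !hK.
Qed.

Definition sparse_class : graph_class := GraphClass sparse_iso.

Lemma sparse_hereditary : hereditary sparse_class.
Proof.
move=> G S; apply: (@sparse_embedding G (induced S) val) => //.
exact: val_inj.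
Qed.

(** A path of length at most [d] between two neighbors of [v], avoiding [v], would give two paths
    from [v] to one of them, of lengths at most [d + 1] and 1; hence [d + 2]. *)
Lemma neighbors_independent (G : sgraph) (v : G) (d : nat) (A : {set G}) :
  unique_short_paths (@sedge G) (d + 2) -> A \subset neighbors sedge v ->
  independent d [set x : delete_vertices [set v] | val x \in A].
Proof.
move=> U /subsetP AN x y; rewrite !inE => xA yA xy; apply/negP.
case/dist_leP => p [xp up py pd]; case/eqP: xy; apply: val_inj.
have vE (z : delete_vertices [set v]) : v != val z.
  by have := valP z; rewrite !inE eq_sym.
have [vx vy] : sedge v (val x) /\ sedge v (val y).
  by split; [have := AN _ xA | have := AN _ yA]; rewrite inE.
suff [] : val x :: map val p = [:: val y] by [].
apply: (U v).
- by rewrite /= vx path_map.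
- rewrite -map_cons cons_uniq map_inj_uniq ?up ?andbT; last exact: val_inj.
  by apply/mapP => -[z _ vz]; case/eqP: (vE z).
- by rewrite /= vy.
- by rewrite /= inE vE.
- by rewrite /= last_map py.
- by rewrite /= size_map addn1 addn2 !ltnS.
Qed.

(** Each chosen vertex rules out a ball of at most [D.+1 ^ d] vertices, so a vertex remains until
    [m] are chosen. *)
Lemma greedy_independent (G : sgraph) (D d m : nat) :
  (forall x : G, #|neighbors sedge x| <= D) -> m * D.+1 ^ d <= #|G| ->
  exists2 X : {set G}, independent d X & #|X| = m.
Proof.
move=> degD; elim: m => [|m IHm] le_G.
  by exists set0; rewrite ?cards0 // => x y; rewrite inE.
have D_gt0 : 0 < D.+1 ^ d by rewrite expn_gt0.
have [|X indX cardX] := IHm.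
  by apply: leq_trans le_G; rewrite leq_mul2r leqnSn orbT.
pose W := \bigcup_(x in X) ball sedge d x.
have [z zW] : exists z, z \notin W.
  apply/existsP; rewrite -negb_forall; apply/negP => /forallP allW.
  have : #|G| <= m * D.+1 ^ d.
    rewrite -cardsT -cardX -sum_nat_const.
    apply: (@leq_trans #|W|); first by apply/subset_leq_card/subsetP => x _.
    apply: leq_trans (card_bigcup_leq _ _) _.
    by apply: leq_sum => x _; apply: card_ball.
  by move: le_G D_gt0; rewrite mulSn; lia.
have far x : x \in X -> z \notin ball sedge d x.
  by move=> xX; apply: contra zW => zx; apply/bigcupP; exists x.
have zX : z \notin X.
  by apply/negP => /far /ballP []; exists [::].
exists (z |: X); last by rewrite cardsU1 zX cardX.
move=> x y; rewrite !inE => /orP [/eqP ->|xX] /orP [/eqP ->|yX];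
  rewrite ?eqxx //.
- move=> _; apply: contra (far _ yX) => /dist_le_ball.
  by apply: ball_sym; apply: sedge_sym.
- by move=> _; apply: contra (far _ xX) => /dist_le_ball.
- exact: indX.
Qed.

Lemma sparse_almost_wide : almost_wide sparse_class.
Proof.
(* The first bound forces girth above [d + 2]; the second is what the greedy choice needs for
   degrees at most [m.-1]. *)
exists 1 => d _; exists (fun m => maxn (M (d + 2)).+1 (m * m ^ d)) => m m_gt0 G.
move=> /(_ (d + 2)) spG; rewrite geq_max => /andP [M_lt mG].
case: spG => [U|]; last by rewrite leqNgt M_lt.
have [/forallP deg|] := boolP [forall x : G, #|neighbors sedge x| < m].
  exists set0; first by rewrite cards0.
  apply: (@greedy_independent _ m.-1).
    move=> x; rewrite -ltnS prednK //; apply: leq_ltn_trans (deg (val x)).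
    rewrite -(card_imset _ val_inj); apply/subset_leq_card/subsetP => z.
    by case/imsetP=> y + ->; rewrite !inE.
  rewrite prednK //; apply: leq_trans mG _.
  by rewrite card_sig -cardsT; apply/subset_leq_card/subsetP => x; rewrite !inE.
rewrite negb_forall => /existsP [v]; rewrite -leqNgt.
case/card_geqP => s [us sm /subsetP sN].
exists [set v]; first by rewrite cards1.
exists [set x : delete_vertices [set v] | val x \in [set x in s]].
  apply: neighbors_independent => //.
  by apply/subsetP => x; rewrite inE => /(subsetP sN).
rewrite -(card_imset _ val_inj) -sm -(card_uniqP us).
apply: eq_card => x; apply/imsetP/idP => [[y + ->]|xs]; first by rewrite !inE.
have xv : x \in ~: [set v].
  rewrite !inE; apply/eqP => xv; have := subsetP sN _ xs.
  by rewrite xv inE sedge_irrefl.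
by exists (Sub x xv); rewrite ?inE ?SubK.
Qed.

End Classes.

(** * Treewidth of balls *)

Section TreeBall.
Variables (G : sgraph) (v : G) (r : nat).
Hypothesis U : unique_short_paths (@sedge G) (2 * r).+1.
Let B := induced (neighborhood r v).

(* The ball is a tree rooted at [v], where [pp x] is the path from [v] to [x];
   the bag of [t] consists of [t] and its parent. *)
Lemma treewidth_ball : treewidth B <= 1.
Proof.
have /choice [pp ppP] : forall x : B, exists p, [/\ path sedge v p,
    uniq (v :: p), last v p = val x & size p <= r].
  by move=> x; apply/dist_leP; have := valP x; rewrite inE.
(* Length [r.+1] covers a path of [pp] extended by one edge; with the [r] of [pp x] the total is
   [(2 * r).+1]. *)
have ppE (x : B) p : path sedge v p -> uniq (v :: p) -> last v p = val x ->
    size p <= r.+1 -> pp x = p.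
  move=> vp up px pr; have [vx ux xE xr] := ppP x.
  by apply: (U vx ux vp up); [rewrite px | lia].
have pp_inj : injective pp.
  move=> x y xy; apply: val_inj.
  by have [_ _ <- _] := ppP x; have [_ _ <- _] := ppP y; rewrite xy.
pose child (u w : B) := pp w == rcons (pp u) (val w).
have edge_child (u w : B) : sedge u w -> child u w || child w u.
  move=> uw; have {}uw : sedge (val u) (val w) by [].
  have [vu uu uE ur] := ppP u; rewrite /child.
  (* If [w] is off the path to [u], that path extended by the edge is the path to [w]. Otherwise its
     part after [w] must be the single edge to [u]. *)
  have [|wN] := boolP (val w \in v :: pp u); last first.
    rewrite (@ppE w (rcons (pp u) (val w))) ?eqxx //.
    - by rewrite rcons_path vu uE.
    - by rewrite -rcons_cons rcons_uniq wN uu.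
    - by rewrite last_rcons.
    - by rewrite size_rcons.
  case/splitPl E: {-1}(pp u) / => [p1 p2 p1w].
  rewrite E cat_path last_cat p1w -cat_cons cat_uniq lastI p1w in vu uu uE.
  have [/andP [vp1 wp2] /and3P [up1 p12 up2]] := (vu, uu).
  have -> : p2 = [:: val u].
    apply: (U wp2 _ (q := [:: val u])) => //=.
    - rewrite up2 andbT; apply: contra p12 => wp.
      by apply/hasP; exists (val w) => //; rewrite mem_rcons mem_head.
    - by rewrite sedge_sym uw.
    - rewrite inE andbT; apply/negP => /eqP/val_inj wu.
      by rewrite wu sedge_irrefl in uw.
    - by move: ur; rewrite E size_cat; lia.
  rewrite cats1 (@ppE w p1) ?eqxx ?orbT // ?lastI ?p1w //.
  by move: ur; rewrite E size_cat; lia.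
have rootP : v \in neighborhood r v by rewrite inE; apply/dist_leP; exists [::].
pose root : B := Sub v rootP.
have conn_root (x : B) : connect sedge root x.
  move: {2}(size (pp x)) (leqnn (size (pp x))) => n; elim: n x => [|n IHn] x.
    rewrite leqn0 size_eq0 => /eqP x0; have [_ _ + _] := ppP x.
    by rewrite x0 => xv; rewrite (_ : x = root) //; apply: val_inj.
  have [+ + + +] := ppP x; case/lastP E : (pp x) => [|p y].
    by move=> _ _ xv _ _; rewrite (_ : x = root) //; apply: val_inj.
  rewrite rcons_path -rcons_cons rcons_uniq last_rcons size_rcons.
  move=> /andP [vp py] /andP [_ up] yx pr pn.
  have zP : last v p \in neighborhood r v.
    by rewrite inE; apply/dist_leP; exists p; split=> //; apply: ltnW.
  pose z : B := Sub (last v p) zP.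
  apply: (connect_trans (IHn z _)).
    by rewrite (@ppE z p) // ltnW // ltnW.
  by apply: connect1; rewrite /= /induced_edge /= -yx.
have conn (x y : B) : connect sedge x y.
  apply: connect_trans (conn_root y).
  by rewrite (sym_connect_sym (@sedge_sym B)).
have treeB : is_tree B.
  split=> //; first by apply/card_gt0P; exists root.
  move=> c; rewrite leqNgt; case: c => // z0 c0 cyc; apply/negP => c_gt2.
  (* Both cycle neighbors of a deepest vertex [z] are its parent, so they coincide by injectivity of
     [pp]; a cycle of length at least 3 forbids this. *)
  have [z zc zmax] := arg_maxnP (fun x : B => size (pp x)) (mem_head z0 c0).
  have [i p cE] := rot_to zc.
  move: cyc c_gt2; rewrite -(rot_ucycle i) -(size_rot i) cE.
  case: p cE => [|y p] //; case/lastP: p => [|p w] // cE.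
  rewrite /ucycle /= rcons_path last_rcons => /andP [/andP [zy /andP [_ wz]]].
  have child_max (x : B) : x \in z0 :: c0 -> sedge z x -> child x z.
    move=> xc /edge_child /orP [/eqP zx|//]; have := zmax x xc.
    by rewrite /= zx size_rcons ltnn.
  have inc x : x \in z :: y :: rcons p w -> x \in z0 :: c0.
    by rewrite -cE mem_rot.
  have /eqP yz : child y z.
    by apply: child_max => //; apply: inc; rewrite !inE eqxx orbT.
  have /eqP : child w z.
    apply: child_max; last by rewrite sedge_sym.
    by apply: inc; rewrite !inE mem_rcons mem_head !orbT.
  rewrite yz => /rcons_inj [/pp_inj ->].
  by rewrite mem_rcons mem_head /= andbF.
pose bag (t : B) : {set B} := t |: [set u | child u t].
have bag_vertex x : exists t, x \in bag t by exists x; rewrite !inE eqxx.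
have bag_edge (x y : B) : sedge x y -> exists t, (x \in bag t) && (y \in bag t).
  by case/edge_child/orP => [xy|yx]; [exists y | exists x];
    rewrite !inE ?xy ?yx eqxx ?orbT.
have child_edge (u w : B) : child u w -> sedge u w.
  move/eqP=> uw; have [+ _ _ _] := ppP w; have [_ _ uE _] := ppP u.
  by rewrite uw rcons_path uE => /andP [].
(* The bags containing [x] are those of [x] and of its children, a star centered at [x]. *)
have bag_connected (x : B) : connected (induced [set t | x \in bag t]).
  have xP : x \in [set t | x \in bag t] by rewrite !inE eqxx.
  have conn_x t : connect sedge (Sub x xP : induced _) t.
    have := valP t; rewrite !inE => /orP [/eqP xt|xt].
      by rewrite (_ : t = Sub x xP) //; apply: val_inj.
    by apply: connect1; apply: child_edge.
  move=> s t; apply: connect_trans (conn_x t).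
  by rewrite (sym_connect_sym (@sedge_sym _)).
pose T := TreeDecomposition treeB bag_vertex bag_edge bag_connected.
apply: (@leq_trans (width T)); last first.
  rewrite /width -subn1 leq_subLR.
  apply/bigmax_leqP => t _; apply: leq_trans (leq_card_setU _ _) _.
  rewrite cards1 leq_add2l; apply/card_le1_eqP => x y; rewrite !inE.
  by move=> /eqP xt /eqP; rewrite xt => /rcons_inj [/pp_inj].
rewrite /treewidth; case: ex_minnP => k _; apply; apply/asboolP.
by exists T.
Qed.

End TreeBall.

Lemma treewidth_leq_card (G : sgraph) : treewidth G <= #|G|.
Proof.
rewrite /treewidth; case: ex_minnP => k /asboolP [T <-] _.
apply: leq_trans (leq_pred _) _.
by apply/bigmax_leqP => t _; apply: max_card.
Qed.

Lemma sparse_locally_bounded_treewidth (M : nat -> nat) :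
  locally_bounded_treewidth (sparse_class M).
Proof.
(* The value 1 serves graphs of girth above [(2 * r).+1]; the other members have at most
   [M (2 * r).+1] vertices. *)
exists (fun r => maxn 1 (M (2 * r).+1)) => r G v /(_ (2 * r).+1) [U|le_M].
  by rewrite leq_max treewidth_ball.
rewrite leq_max; apply/orP; right; apply: leq_trans (treewidth_leq_card _) _.
by apply: leq_trans le_M; rewrite card_sig max_card.
Qed.

(** * One poset for each dimension bound, collected in a single class *)

Theorem proposition2 :
  exists C : graph_class,
    [/\ hereditary C, almost_wide C, locally_bounded_treewidth C
      & forall d : nat,
          exists (disp : Order.disp_t) (P : finPOrderType disp),
            [/\ height P = 2, C (cover_graph P) & d <= dim P]].
Proof.
have [n nP] := choice high_dim_bipartite_poset.
(* The poset chosen for [d] has girth above [g] when [g <= d]; otherwise its size is one of the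
   terms of the maximum. *)
exists (sparse_class (fun g => \max_(k < g) (n k + n k))); split.
- exact: sparse_hereditary.
- exact: sparse_almost_wide.
- exact: sparse_locally_bounded_treewidth.
move=> d; have [F [U F0 dF]] := nP d.
exists (Order.Disp tt tt), (bipartite_poset F).
split=> //; first exact: height_bipartite_poset.
move=> g; have [gd|dg] := leqP g d; [left|right].
  apply: (unique_short_paths_leq gd).
  apply: (unique_short_paths_inj (f := id)) U => // x y.
  exact: cover_edge_bipartite_poset.
rewrite card_sum !card_ord.
exact: (leq_bigmax (Ordinal dg)).
Qed.
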